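(* Let $n \in \mathbb{N}$ and let $s$ be an integer with $-n \le s \le n+1$. Then the Töplitz determinant $\mathcal{N}^{(s)}_{n}(t,q) = \det(N_{s+j-k-1}(t,q))_{j,k=0,\ldots,n-1}$ of the $q$-Narayana polynomials is given by $$\mathcal{N}^{(s)}_{n}(t,q) = \varphi^{(s)}_{n}(t,q) \prod_{k=1}^{s-1} (t+q^{2k-1})^{s-k} \qquad \text{for } 1 \le s \le n+1,$$ $$\mathcal{N}^{(s)}_{n}(t,q) = \varphi^{(s)}_{n}(t,q) \prod_{k=1}^{|s|} (t+q^{-2k+1})^{|s|-k+1} \qquad \text{for } -n \le s \le 0,$$ where $$\varphi^{(s)}_{n}(t,q) = (-1)^{\frac{n(n-1)}{2}}\, t^{-\frac{(n-s)(n-s+1)}{2}}\, q^{\frac{n(n-1)(2s-1)}{2}}.$$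
   Context: $\mathbb{N}=\{0,1,2,\ldots\}$; empty products and $0\times 0$ determinants equal $1$. A Schröder path is a lattice path in $\mathbb{Z}^2$ consisting of up steps $(1,1)$, down steps $(1,-1)$ and level steps $(2,0)$, never going beneath the $x$-axis (the path without steps is allowed). For $k\in\mathbb{N}$, $S_k$ is the set of Schröder paths from $(0,0)$ to $(2k,0)$. For a Schröder path $P$, $\mathrm{level}(P)$ is the number of level steps in $P$ and $\mathrm{area}(P)$ is the area of the region between $P$ and the $x$-axis. The $q$-Narayana polynomials are $$N_k(t,q)=\sum_{P\in S_k} t^{\mathrm{level}(P)} q^{\mathrm{area}(P)},\qquad k\in\mathbb{N},$$ with $t,q$ indeterminates (or nonzero constants). For negative integers $k$ one defines $$N_k(t,q)=t^{-2|k|+1} N_{|k|-1}(t,q^{-1}),\qquad k<0.$$ *)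

(* Defs.v *)
From HB Require Import structures.
From mathcomp Require Import all_boot all_order all_algebra.
From mathcomp Require Import zify ring.

Set Implicit Arguments.
Unset Strict Implicit.
Unset Printing Implicit Defensive.

Import Order.TTheory GRing.Theory Num.Theory.
Local Open Scope ring_scope.

Inductive step := Up | Down | Level.

Definition code (a : step) : option bool :=
  match a with Up => Some true | Down => Some false | Level => None end.

Definition decode (x : option bool) : step :=
  match x with Some true => Up | Some false => Down | None => Level end.

Lemma codeK : cancel code decode. Proof. by case. Qed.

HB.instance Definition _ := Finite.copy step (can_type codeK).

Definition vec (a : step) : int * int :=
  match a with Up => (1, 1) | Down => (1, -1) | Level => (2, 0) end.

(* A path is encoded by its sequence of steps; it starts at the origin. *)
Definition vertices (p : seq step) : seq (int * int) :=
  (0, 0) :: scanl (fun v a => v + vec a) (0, 0) p.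

Definition endpoint (p : seq step) : int * int := last (0, 0) (vertices p).

(* Steps are straight segments, so it suffices to test the vertices. *)
Definition nonneg (p : seq step) : bool :=
  all (fun v : int * int => 0 <= v.2) (vertices p).

(* [schroder k p]: p is a Schroeder path from (0,0) to (2k,0). *)
Definition schroder (k : nat) (p : seq step) : bool :=
  nonneg p && (endpoint p == ((2 * k)%:Z, 0)).

(* Such a path has at most 2k steps (lemma [schroder_size] below), so bounded
   sequences exhaust the set. *)
Definition Schroder (k : nat) : {set (2 * k).-bseq step} :=
  [set p : (2 * k).-bseq step | schroder k p].

Definition level (p : seq step) : nat := count_mem Level p.

(* Twice the area under p, by the trapezoid rule edge by edge. It is even for a
   path that ends at an even abscissa (lemma [dvdz_area2] below), so that the
   division by 2 in [area] is exact on Schroeder paths. *)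
Definition area2 (p : seq step) : int :=
  \sum_(e <- zip (vertices p) (behead (vertices p)))
    (e.2.1 - e.1.1) * (e.1.2 + e.2.2).

Definition area (p : seq step) : int := (area2 p %/ 2)%Z.

Definition narayana_nat (F : fieldType) (t q : F) (k : nat) : F :=
  \sum_(p in Schroder k) t ^+ level p * q ^ area p.

Definition narayana (F : fieldType) (t q : F) (k : int) : F :=
  if 0 <= k then narayana_nat t q `|k|%N
  else t ^ (- 2 * `|k| + 1) * narayana_nat t q^-1 (`|k|%N - 1)%N.

Definition narayana_toeplitz (F : fieldType) (t q : F) (n : nat) (s : int) : F :=
  \det (\matrix_(j < n, k < n) narayana t q (s + j%:Z - k%:Z - 1)).

(* All three divisions by 2 are exact. *)
Definition phi (F : fieldType) (t q : F) (n : nat) (s : int) : F :=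
  (-1) ^ (n%:Z * (n%:Z - 1) %/ 2)%Z
  * t ^ (- ((n%:Z - s) * (n%:Z - s + 1) %/ 2)%Z)
  * q ^ (n%:Z * (n%:Z - 1) * (2 * s - 1) %/ 2)%Z.

Lemma schroder_size k p : schroder k p -> (size p <= 2 * k)%N.
Proof.
have H v : v.1 + (size p)%:Z <= (last v (scanl (fun v a => v + vec a) v p)).1.
  elim: p v => [|a p IH] v /=; first by rewrite addr0.
  by apply: le_trans (IH _); case: a => /=; lia.
case/andP=> _ /eqP E; have := H (0, 0).
by rewrite -[last _ _]/(endpoint p) E /= add0r lez_nat.
Qed.

Lemma dvdz_area2 p : (2 %| area2 p - (endpoint p).1)%Z.
Proof.
pose P v := scanl (fun v a => v + vec a) v p.
have H v : exists c : int, \sum_(e <- zip (v :: P v) (P v))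
    (e.2.1 - e.1.1) * (e.1.2 + e.2.2) = 2 * c + ((last v (P v)).1 - v.1).
  rewrite {}/P; elim: p v => [|a p IH] v /=; first by exists 0; rewrite big_nil subrr.
  rewrite big_cons /=; have [c ->] := IH (v + vec a).
  by case: a => /=; [exists (c + v.2) | exists (c + v.2 - 1) | exists (c + 2 * v.2 - 1)]; ring.
have [c] := H (0, 0); rewrite -/(area2 p) -[last _ _]/(endpoint p) => ->.
by rewrite subr0 addrK dvdz_mulr.
Qed.

(* Main.v *)
(** Weight a Schröder path by giving level steps at height h the factor
    t q^(2h) and down steps from height h the factor q^(2h-1). The weighted
    counts of paths that start at height n, glued with those for (t, q^-1) on
    negative indices, form a family f_n(i), i in Z, with f_0 = N and
      f_(n+1)(i) = f_n(i) - t q^(2n) f_n(i-1) - q^(2n-1) f_(n-1)(i-1).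
    Hence the f_n are combinations of shifts of N, that is, column operations
    turn the Toeplitz matrix for s = 1 into (f_k(j))_(j,k). This matrix is
    triangular, since a path starting at height k needs k steps to come down.
    The symmetry N_i(t,q) = t^(2i+1) N_(-1-i)(t,q^-1) exchanges s and 1 - s,
    which gives s = 0. The Desnanot-Jacobi identity
      T_(n+1)^s T_(n-1)^s = (T_n^s)^2 - T_n^(s+1) T_n^(s-1)
    then determines T_n^(s+1) for n >= s by induction on s, provided that no
    factor t + q^k vanishes. To remove this proviso, t is replaced by an
    indeterminate over F and specialized afterwards. *)

Require Import Defs.
From mathcomp Require Import all_boot all_order all_algebra.
From mathcomp Require Import zify ring.

Set Implicit Arguments.
Unset Strict Implicit.
Unset Printing Implicit Defensive.

Import Order.TTheory GRing.Theory Num.Theory.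
Local Open Scope ring_scope.

(** * Enumeration of Schröder paths by their first step *)

(** [m] is the horizontal distance still to cover and [h] the current height. *)
Fixpoint paths (m h : nat) : seq (seq step) :=
  if m is m1.+1 then
    [seq Up :: p | p <- paths m1 h.+1] ++
    (if h is h1.+1 then [seq Down :: p | p <- paths m1 h1] else [::]) ++
    (if m1 is m2.+1 then [seq Level :: p | p <- paths m2 h] else [::])
  else if h is 0%N then [:: [::]] else [::].

Lemma count_map_cons (a b : step) (p : seq step) (s : seq (seq step)) :
  count_mem (a :: p) [seq b :: r | r <- s] = ((a == b) * count_mem p s)%N.
Proof.
rewrite count_map; case: (eqVneq a b) => [->|ab]; rewrite ?mul1n ?mul0n.
  by apply: eq_count => r /=; rewrite eqseq_cons eqxx.
rewrite -(count_pred0 s); apply: eq_count => r /=.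
by rewrite eqseq_cons eq_sym (negPf ab).
Qed.

Lemma count_map_nil (b : step) (s : seq (seq step)) :
  count_mem [::] [seq b :: r | r <- s] = 0%N.
Proof. by rewrite count_map -(count_pred0 s); apply: eq_count. Qed.

Definition walk (v : int * int) (p : seq step) : seq (int * int) :=
  scanl (fun v a => v + vec a) v p.

Lemma walk_le_last (v : int * int) (p : seq step) :
  v.1 + (size p)%:Z <= (last v (walk v p)).1.
Proof.
rewrite /walk; elim: p v => [|a p IH] v /=; first by rewrite addr0.
by apply: le_trans (IH _); case: a => /=; lia.
Qed.

(** Counting occurrences shows at once that every admissible path is listed and that none is listed
    twice. The abscissa [x] is free because the induction moves the starting point. *)
Lemma count_paths (p : seq step) (m h : nat) (x : int) :
  count_mem p (paths m h) =
  all (fun v : int * int => 0 <= v.2) (walk (x, h%:Z) p) &&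
  (last (x, h%:Z) (walk (x, h%:Z) p) == (x + m%:Z, 0)).
Proof.
elim: p m h x => [|a p IH] m h x.
  rewrite /= xpair_eqE.
  have -> : count_mem [::] (paths m h) = ((m == 0%N) && (h == 0%N)).
    by case: m h => [|[|m]] [|h] //=; rewrite ?count_cat ?count_map_nil.
  by rewrite -[X in X == x + _]addr0 (inj_eq (addrI x)) [0 == _]eq_sym.
(* Each step advances the abscissa by at least one, so under this bound the walk ends beyond the
   target. *)
have far (m' : nat) (v : int * int) : m'%:Z < v.1 - x + (size p)%:Z ->
    (last v (walk v p) == (x + m'%:Z, 0)) = false.
  by move=> H; apply/eqP => E; have := walk_le_last v p; rewrite E /=; lia.
have shift : walk (x, h%:Z) (a :: p) =
    (x, h%:Z) + vec a :: walk ((x, h%:Z) + vec a) p by [].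
rewrite shift [all _ _]/= [last _ _]/=.
case: a shift => _.
- have -> : (x, h%:Z) + vec Up = (x + 1, h.+1%:Z).
    by congr (_, _); rewrite /=; lia.
  case: m => [|m]; first by rewrite far ?andbF /=; [case: h | rewrite /=; lia].
  rewrite -[x + m.+1%:Z]/(x + (1 + m%:Z)) addrA -IH.
  rewrite /= !count_cat count_map_cons mul1n.
  by case: h m => [|h] [|m]; rewrite ?count_map_cons ?addn0 //= ?addn0.
- case: h => [|h].
    rewrite [(0 <= _)%R]/= /=.
    case: m => [|[|m]] //=; rewrite ?count_cat ?count_map_cons //=.
  have -> : (x, h.+1%:Z) + vec Down = (x + 1, h%:Z).
    by congr (_, _); rewrite /=; lia.
  case: m => [|m]; first by rewrite far ?andbF /=; rewrite /=; lia.
  rewrite -[x + m.+1%:Z]/(x + (1 + m%:Z)) addrA -IH.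
  rewrite /= !count_cat !count_map_cons mul1n.
  by case: m => [|m]; rewrite ?count_map_cons ?addn0 //= ?addn0.
- have -> : (x, h%:Z) + vec Level = (x + 2, h%:Z).
    by congr (_, _); rewrite /=; lia.
  case: m => [|[|m]]; first by rewrite far ?andbF /=; [case: h | rewrite /=; lia].
    rewrite far ?andbF; last by rewrite /=; lia.
    by case: h => [|h]; rewrite /= ?count_cat ?count_map_cons.
  have -> : x + m.+2%:Z = x + 2 + m%:Z by lia.
  have -> : 0 <= h%:Z + (vec Level).2 by rewrite /=; lia.
  rewrite -IH.
  rewrite /= !count_cat !count_map_cons mul1n.
  by case: h => [|h]; rewrite ?count_map_cons ?add0n //= ?add0n.
Qed.

(** * Weighted path counts and their relation to the area *)

Section Weights.
Variables (F : fieldType) (t q : F).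

(* An up step from height h contributes 2h + 1 = (h+1)^2 - h^2 to twice the
   area. These differences telescope, so that no half-integer powers of q are
   needed if the area is charged to the down and level steps. *)
Fixpoint weight (h : nat) (p : seq step) : F :=
  match p with
  | [::] => 1
  | Up :: p' => weight h.+1 p'
  | Down :: p' => q ^+ (2 * h - 1) * weight h.-1 p'
  | Level :: p' => t * q ^+ (2 * h) * weight h p'
  end.

Definition wsum (m h : nat) : F := \sum_(p <- paths m h) weight h p.

Lemma wsum0 (h : nat) : wsum 0 h = (h == 0%N)%:R.
Proof. by case: h => [|h]; rewrite /wsum /= ?big_nil // big_cons big_nil addr0. Qed.

Lemma wsum1 (h : nat) : wsum 1 h = (h == 1%N)%:R * q.
Proof.
rewrite /wsum; case: h => [|[|h]] /=; rewrite ?big_nil ?mul0r //.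
by rewrite big_cons big_nil addr0 /= mulr1 mul1r.
Qed.

Lemma wsumSS (m h : nat) :
  wsum m.+2 h = wsum m.+1 h.+1 + t * q ^+ (2 * h) * wsum m h
   + (0 < h)%N%:R * q ^+ (2 * h - 1) * wsum m.+1 h.-1.
Proof.
rewrite /wsum.
have -> : paths m.+2 h = [seq Up :: p | p <- paths m.+1 h.+1] ++
    (if h is h1.+1 then [seq Down :: p | p <- paths m.+1 h1] else [::]) ++
    [seq Level :: p | p <- paths m h] by [].
move: (paths m.+1) (paths m) => u v.
rewrite !big_cat !big_map /= -addrA; congr (_ + _); rewrite addrC mulr_sumr.
congr (_ + _); case: h => [|h]; rewrite ?big_nil ?mul0r //.
by rewrite big_map mul1r mulr_sumr.
Qed.

Lemma wsum_small (m h : nat) : (m < h)%N -> wsum m h = 0.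
Proof.
elim/ltn_ind: m h => -[|[|m]] IH h mh; rewrite ?wsum0 ?wsum1 ?wsumSS.
- by case: h mh.
- by case: h mh => [|[|h]] //; rewrite mul0r.
- by rewrite !IH ?mulr0 ?addr0 //; lia.
Qed.

(** Only the path of [h] down steps remains; its exponents are the odd numbers 1, 3, ..., 2h - 1. *)
Lemma wsum_diag (h : nat) : wsum h h = q ^+ (h ^ 2).
Proof.
elim: h => [|[|h] IH]; first by rewrite wsum0.
  by rewrite wsum1 mul1r expr1.
rewrite wsumSS [wsum _ h.+3]wsum_small // [wsum h _]wsum_small // mulr0 !add0r mul1r IH.
by rewrite -exprD; congr (_ ^+ _); lia.
Qed.

End Weights.

(** Each step adds to twice the area twice its exponent in [weight] plus the increment of the
    squared height; these increments telescope to -h^2. *)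
Lemma weight_area (F : fieldType) (t q : F) (p : seq step) (x : int) (h : nat) :
  all (fun v : int * int => 0 <= v.2) (walk (x, h%:Z) p) ->
  (last (x, h%:Z) (walk (x, h%:Z) p)).2 = 0 ->
  exists2 b : nat, weight t q h p = t ^+ level p * q ^+ b &
    \sum_(e <- zip ((x, h%:Z) :: walk (x, h%:Z) p) (walk (x, h%:Z) p))
      (e.2.1 - e.1.1) * (e.1.2 + e.2.2) = 2 * b%:Z - (h ^ 2)%N%:Z.
Proof.
elim: p x h => [|a p IH] x h.
  by move=> _ /= [->]; exists 0%N; rewrite ?big_nil ?mulr1.
have -> : walk (x, h%:Z) (a :: p) =
    (x, h%:Z) + vec a :: walk ((x, h%:Z) + vec a) p by [].
rewrite [all _ _]/= [last _ _]/= [zip _ _]/= big_cons.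
case/andP => hge; case: a hge => hge.
- have -> : (x, h%:Z) + vec Up = (x + 1, h.+1%:Z).
    by congr (_, _); rewrite /=; lia.
  move=> pos end0; have [b wE aE] := IH _ _ pos end0; exists b => //.
  by rewrite aE /=; lia.
- case: h hge => [|h] // _.
  have -> : (x, h.+1%:Z) + vec Down = (x + 1, h%:Z).
    by congr (_, _); rewrite /=; lia.
  move=> pos end0; have [b wE aE] := IH _ _ pos end0.
  exists (2 * h.+1 - 1 + b)%N; first by rewrite [weight _ _ _ _]/= wE exprD mulrCA.
  by rewrite aE /=; lia.
- have -> : (x, h%:Z) + vec Level = (x + 2, h%:Z).
    by congr (_, _); rewrite /=; lia.
  move=> pos end0; have [b wE aE] := IH _ _ pos end0.
  exists (2 * h + b)%N; first rewrite [weight _ _ _ _]/= wE.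
    by rewrite -[level (Level :: p)]/(level p).+1 exprS [q ^+ (_ + b)]exprD; ring.
  by rewrite aE /=; lia.
Qed.

Lemma narayana_natE (F : fieldType) (t q : F) (k : nat) :
  narayana_nat t q k = wsum t q (2 * k) 0.
Proof.
have pathsE p : count_mem p (paths (2 * k) 0) = schroder k p.
  by rewrite (count_paths p (2 * k) 0 0) add0r.
(* Neither list repeats an element, so it suffices to compare membership. *)
have sE : perm_eq (map val (enum (Schroder k))) (paths (2 * k) 0).
  apply/allP => p _ /=; apply/eqP.
  rewrite pathsE count_uniq_mem; last first.
    by rewrite map_inj_uniq ?enum_uniq //; exact: val_inj.
  congr nat_of_bool; apply/mapP/idP => [[r]|pS].
    by rewrite mem_enum inE => rS ->.
  by exists (Bseq (schroder_size pS)) => //; rewrite mem_enum inE.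
rewrite /narayana_nat /wsum -(perm_big _ sE) big_map big_enum /=.
apply: eq_bigr => p; rewrite inE => /andP[/= pos /eqP pe].
have [b wE aE] := weight_area t q pos (f_equal snd pe).
rewrite wE /area /area2 -[behead _]/(walk (0, 0%N%:Z) p).
by rewrite -[vertices p]/(_ :: walk (0, 0%N%:Z) p) aE subr0 mulKz.
Qed.

(** * Triangular factorization for [s = 1] *)

Section Biorthogonal.
Variables (F : fieldType) (t q : F).
Hypotheses (t0 : t != 0) (q0 : q != 0).

(* For negative i the factor in front of [wsum] is forced by [moment_rec].
   Truncation of [2 * j - n] is harmless: if 2j < n, then [wsum 0 n] vanishes. *)
Definition moment (n : nat) (i : int) : F :=
  match i with
  | Posz j => wsum t q (2 * j - n) n
  | Negz j => (- t^-1) ^+ n * q ^+ (n * n.-1) * t ^- (2 * j + 1) *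
              wsum t q^-1 (2 * j + n) n
  end.

Lemma moment0E (i : int) : moment 0 i = narayana t q i.
Proof.
case: i => j; rewrite /narayana /= narayana_natE ?subn0 ?subn1 //=.
by rewrite !mul1r addn0 exprnN; congr (t ^ _ * _); lia.
Qed.

(** For positive [i] this is [wsumSS] solved for the paths starting one unit higher; for negative
    [i] it is [wsumSS] for [q^-1], rescaled. At [i = 0], where the two halves meet, all values are
    explicit. *)
Lemma moment_rec (n : nat) (i : int) :
  moment n.+1 i = moment n i - t * q ^+ (2 * n) * moment n (i - 1)
    - (0 < n)%N%:R * q ^+ (2 * n - 1) * moment n.-1 (i - 1).
Proof.
case: i => [[|j]|j].
- have -> : 0%:Z - 1 = Negz 0 by [].
  rewrite /moment !muln0 !sub0n !wsum0 !add0n.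
  case: n => [|n]; rewrite !wsum_diag /= ?mul0r ?subr0.
    by rewrite !muln0 !expr0 !mulr1 mul1r expr1 divff // subrr.
  rewrite mul1r sub0r expr1.
  have -> : (2 * n.+1 - 1 = n + n + 1)%N by lia.
  have -> : (2 * n.+1 = n + n + 2)%N by lia.
  have -> : (n ^ 2 = n * n.-1 + n)%N by nia.
  have -> : (n.+1 ^ 2 = n * n.-1 + n + n + n + 1)%N by nia.
  have -> : (n.+1 * n = n * n.-1 + n + n)%N by nia.
  rewrite [(- t^-1) ^+ _.+1]exprS !exprVn !exprD.
  have : q ^+ (n * n.-1) != 0 by rewrite expf_neq0.
  have : q ^+ n != 0 by rewrite expf_neq0.
  move: (q ^+ (n * n.-1)) (q ^+ n) ((- t^-1) ^+ n) => a b c b0 a0.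
  by field; rewrite q0 t0 a0 b0.
- have -> : j.+1%:Z - 1 = j%:Z by lia.
  rewrite /moment.
  (* [wsumSS] needs two units of abscissa. With fewer, the only nonzero terms occur for [n = 1],
     where they cancel. *)
  case E: (2 * j.+1 - n)%N => [|[|m]].
  + have [-> [-> ->]] : (2 * j.+1 - n.+1 = 0 /\ 2 * j - n = 0 /\
        2 * j - n.-1 = 0)%N by lia.
    have n0 : (0 < n)%N by lia.
    rewrite !wsum0; case: n n0 E => [|[|n]] //= _ E; first by lia.
    by rewrite !mulr0 !subr0.
  + have [-> [-> ->]] : (2 * j.+1 - n.+1 = 0 /\ 2 * j - n = 0 /\
        2 * j - n.-1 = 0)%N by lia.
    rewrite wsum1 !wsum0; case: n E => [|[|n]] E; first by lia.
      by rewrite /= !mul1r mulr0 mulr1 subr0 subrr.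
    by rewrite /= mul0r !mulr0 !subr0.
  + have [-> ->] : (2 * j.+1 - n.+1 = m.+1 /\ 2 * j - n = m)%N by lia.
    rewrite wsumSS; case: n E => [|n] E; first by rewrite /= !mul0r; ring.
    by have -> : (2 * j - n.+1.-1 = m.+1)%N by [lia]; rewrite [n.+1.-1]/=; ring.
- have -> : Negz j - 1 = Negz j.+1 by lia.
  rewrite /moment.
  have -> : (2 * j.+1 + n = (2 * j + n).+2)%N by lia.
  have -> : (2 * j + n.+1 = (2 * j + n).+1)%N by lia.
  rewrite wsumSS; case: n => [|n].
    rewrite !mul0r subr0 addr0 !muln0 !expr0 !mul1r !mulr1 addn0 !expr1.
    have -> : (2 * j.+1 + 1 = 2 * j + 1 + 2)%N by lia.
    move: (2 * j + 1)%N => N; rewrite exprD.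
    have : t ^+ N != 0 by rewrite expf_neq0.
    by move: (wsum _ _ _ _) (wsum _ _ _ _) (t ^+ N) => u v T T0; field; rewrite t0.
  rewrite [n.+1.-1]/= [n.+2.-1]/= !mul1r.
  have -> : (2 * j.+1 + n = (2 * j + n.+1).+1)%N by lia.
  have -> : (2 * j.+1 + 1 = 2 * j + 1 + 2)%N by lia.
  move: (2 * j + 1)%N => N.
  have -> : (2 * n.+1 - 1 = n + n + 1)%N by lia.
  have -> : (2 * n.+1 = n + n + 2)%N by lia.
  have -> : (n.+2 * n.+1 = n * n.-1 + n + n + n + n + 2)%N by nia.
  have -> : (n.+1 * n = n * n.-1 + n + n)%N by nia.
  rewrite ![(- t^-1) ^+ _.+1]exprS !exprVn !exprD.
  have : q ^+ (n * n.-1) != 0 by rewrite expf_neq0.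
  have : q ^+ n != 0 by rewrite expf_neq0.
  have : t ^+ N != 0 by rewrite expf_neq0.
  move: (q ^+ (n * n.-1)) (q ^+ n) ((- t^-1) ^+ n) => a b c T0 b0 a0.
  move: (wsum _ _ _ _) (wsum _ _ _ _) (wsum _ _ _ _) (t ^+ N) T0 => u v w T T0.
  by field; rewrite t0 T0 q0 b0.
Qed.

Let shift (c : nat -> F) (l : nat) : F := if l is l1.+1 then c l1 else 0.

Let sum_shift (c g : nat -> F) (m : nat) :
  \sum_(l < m.+1) shift c l * g l = \sum_(l < m) c l * g l.+1.
Proof. by rewrite big_ord_recl mul0r add0r. Qed.

(** Each use of [moment_rec] multiplies the top coefficient by -t q^(2n). The length [m] is
    arbitrary above [n], so that combinations of different degrees share one range of summation. *)
Lemma moment_comb (n : nat) :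
  exists c : nat -> F, [/\ forall l, (n < l)%N -> c l = 0,
    c n = (- t) ^+ n * q ^+ (n * n.-1) &
    forall (m : nat) (i : int), (n < m)%N ->
      moment n i = \sum_(l < m) c l * moment 0 (i - l%:Z)].
Proof.
elim/ltn_ind: n => -[|n] IH.
  exists (fun l => (l == 0%N)%:R); split => [[]||[|m] i _] //.
    by rewrite mul1r.
  by rewrite big_ord_recl big1 ?mul1r ?subr0 ?addr0 // => l _; rewrite mul0r.
have [c [c0 cn cE]] := IH n (ltnSn n).
(* For [n = 0] the predecessor is truncated to 0; the factor [0 < n] then removes this term. *)
have [d [d0 _ dE]] := IH n.-1 (leq_ltn_trans (leq_pred n) (ltnSn n)).
exists (fun l => c l - t * q ^+ (2 * n) * shift c l
           - (0 < n)%N%:R * q ^+ (2 * n - 1) * shift d l); split.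
- case=> [|l] // nl; rewrite /= !c0 ?d0 ?mulr0 ?subr0 //; lia.
- rewrite /= c0 // cn sub0r.
  have -> : (0 < n)%N%:R * q ^+ (2 * n - 1) * d n = 0.
    by case: n {IH c c0 cn cE dE} d0 => [|n] d0; rewrite ?mul0r // d0 ?mulr0.
  rewrite subr0 exprS.
  have -> : (n.+1 * n = 2 * n + n * n.-1)%N by nia.
  by rewrite exprD; ring.
- case=> [|m] i // nm.
  rewrite moment_rec (cE m.+1) 1?(cE m (i - 1)) 1?(dE m (i - 1)); try lia.
  under [RHS]eq_bigr => l _ do rewrite !mulrBl -!mulrA.
  rewrite !sumrB -!mulr_sumr -!mulrA.
  rewrite !(sum_shift _ (fun l => moment 0 (i - l%:Z))).
  by congr (_ - _ * (_ * _) - _ * (_ * _)); apply: eq_bigr => l _;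
    congr (_ * moment 0 _); lia.
Qed.

(** In [M = T *m C] the matrix [M] is lower and [C] upper triangular, and the quotient of their
    diagonal entries is q^(k^2) / ((-t)^k q^(k(k-1))) = (-q/t)^k. *)
Lemma toeplitz1_prod (n : nat) :
  narayana_toeplitz t q n 1 = \prod_(k < n) (- (q / t)) ^+ k.
Proof.
have [c cP] := fin_all_exists (fun k : 'I_n => moment_comb k).
pose C : 'M[F]_n := \matrix_(l, k) c k l.
pose M : 'M[F]_n := \matrix_(j, k) moment k j.
pose T : 'M[F]_n := \matrix_(j, k) narayana t q (1 + j%:Z - k%:Z - 1).
have MTC : M = T *m C.
  apply/matrixP => j k; rewrite !mxE; have [_ _ /(_ n _ (ltn_ord k)) ->] := cP k.
  apply: eq_bigr => l _; rewrite !mxE mulrC moment0E; congr (narayana t q _ * _); lia.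
have detM : \det M = \prod_(k < n) q ^+ (k ^ 2).
  rewrite det_trig; last first.
    by apply/is_trig_mxP => j k jk; rewrite mxE /= wsum_small //; lia.
  apply: eq_bigr => k _; rewrite mxE /= -(wsum_diag t); congr wsum; lia.
have detC : \det C = \prod_(k < n) ((- t) ^+ k * q ^+ (k * k.-1)).
  rewrite -det_tr det_trig; last first.
    by apply/is_trig_mxP => j k jk; rewrite !mxE; have [cj0 _ _] := cP j; exact: cj0.
  by apply: eq_bigr => k _; rewrite !mxE; have [_ -> _] := cP k.
have C0 : \det C != 0.
  by rewrite detC; apply/prodf_neq0 => k _; rewrite mulf_neq0 ?expf_neq0 ?oppr_eq0.
apply: (mulIf C0); rewrite -det_mulmx -MTC detM detC -big_split /=.
apply: eq_bigr => k _.
have -> : (k ^ 2 = k + k * k.-1)%N by nia.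
by rewrite exprD mulrA -exprMn; congr (_ ^+ _ * _); field.
Qed.

End Biorthogonal.

(** * Symmetry between [s] and [1 - s] *)

Lemma narayana_sym (F : fieldType) (t q : F) (i : int) : t != 0 ->
  narayana t q i = t ^ (2 * i + 1) * narayana t q^-1 (-1 - i).
Proof.
move=> t0; rewrite /narayana; case: i => j.
  have -> : (0 <= -1 - Posz j) = false by lia.
  have -> : absz (-1 - Posz j)%R = j.+1 by lia.
  rewrite mulrA -expfzDr // invrK /=.
  have -> : 2 * j%:Z + 1 + (- 2 * `|-1 - Posz j| + 1) = 0 by lia.
  by rewrite expr0z mul1r subn1.
have -> : (0 <= -1 - Negz j) = true by lia.
have -> : absz (-1 - Negz j)%R = j by lia.
by rewrite /= subn1; congr (t ^ _ * _); lia.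
Qed.

(** The power of t from [narayana_sym] splits into a row factor and a column factor, and the
    reflection of the index transposes the matrix. *)
Lemma toeplitz_sym (F : fieldType) (t q : F) (n : nat) (s : int) : t != 0 ->
  narayana_toeplitz t q n s =
  t ^ (n%:Z * (2 * s - 1)) * narayana_toeplitz t q^-1 n (1 - s).
Proof.
move=> t0; rewrite /narayana_toeplitz.
set M := \matrix_(j, k) narayana t q^-1 _.
pose d1 : 'rV[F]_n := \row_(j < n) t ^ (2 * s - 1 + 2 * j%:Z).
pose d2 : 'rV[F]_n := \row_(j < n) t ^ (- (2 * j%:Z)).
have -> : \matrix_(j < n, k < n) narayana t q (s + j%:Z - k%:Z - 1) =
    diag_mx d1 *m M^T *m diag_mx d2.
  apply/matrixP => j k; rewrite mul_mx_diag mul_diag_mx !mxE narayana_sym //.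
  rewrite mulrAC -expfzDr //; congr (t ^ _ * narayana t _ _); lia.
rewrite !det_mulmx !det_diag det_tr mulrAC -big_split /=; congr (_ * _).
under eq_bigr => j _ do rewrite !mxE -expfzDr // addrK.
by rewrite prodr_const card_ord exprnP exprz_exp mulrC.
Qed.

(** * The Desnanot-Jacobi identity *)

(** Sylvester's identity, from two block triangular factorizations of one matrix. *)
Lemma det_1D_mulmx (R : comNzRingType) (m n : nat)
    (U : 'M[R]_(m, n)) (V : 'M[R]_(n, m)) :
  \det (1%:M + U *m V) = \det (1%:M + V *m U).
Proof.
have E1 : block_mx (1%:M + U *m V) U 0 1%:M *m block_mx 1%:M 0 (- V) 1%:M =
          block_mx 1%:M U (- V) 1%:M.
  by rewrite mulmx_block !mul0mx !mulmx0 !mul1mx !mulmx1 mulmxN addrK !add0r.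
have E2 : block_mx 1%:M 0 (- V) 1%:M *m block_mx 1%:M U 0 (1%:M + V *m U) =
          block_mx 1%:M U (- V) 1%:M.
  rewrite mulmx_block !mul0mx !mulmx0 !mul1mx !mulmx1 mulNmx !addr0.
  by rewrite [- _ + _]addrC addrK.
have := congr1 determinant (etrans E1 (esym E2)).
by rewrite !det_mulmx !(det_ublock, det_lblock) !det1 !mulr1 !mul1r.
Qed.

Lemma det_2x2 (R : comNzRingType) (A : 'M[R]_2) :
  \det A = A ord0 ord0 * A ord_max ord_max - A ord0 ord_max * A ord_max ord0.
Proof.
rewrite (expand_det_row _ ord0) !big_ord_recl big_ord0 addr0 /cofactor !det_mx11 !mxE.
have -> : lift ord0 ord0 = ord_max :> 'I_2 by apply: val_inj.
have -> : lift ord_max 0 = ord0 :> 'I_2 by apply: val_inj.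
rewrite /= addn0 add0n expr0 expr1; ring.
Qed.

Section Dodgson.
Variables (F : fieldType) (n : nat) (A : 'M[F]_n.+2).

Let i0 : 'I_n.+2 := ord0.
Let i1 : 'I_n.+2 := ord_max.

(* The first and last columns of [A *m X] are [\det A] times unit vectors. *)
Let X : 'M[F]_n.+2 :=
  \matrix_(i, j) if (j == i0) || (j == i1) then \adj A i j else (i == j)%:R.

(** [X] is the identity plus a product through dimension two, so [det_1D_mulmx] leaves a 2 x 2
    determinant of corner entries of the adjugate. *)
Let det_X : \det X = \adj A i0 i0 * \adj A i1 i1 - \adj A i0 i1 * \adj A i1 i0.
Proof.
pose r (k : 'I_2) : 'I_n.+2 := if k == ord0 then i0 else i1.
pose U : 'M[F]_(n.+2, 2) := \matrix_(i, k) (\adj A i (r k) - (i == r k)%:R).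
pose V : 'M[F]_(2, n.+2) := \matrix_(k, j) (j == r k)%:R.
have -> : X = 1%:M + U *m V.
  apply/matrixP => i j; rewrite !mxE !big_ord_recl big_ord0 !mxE addr0 /r /=.
  case: (eqVneq j i0) => [->|ji0]; last case: (eqVneq j i1) => [->|ji1] /=.
  - by rewrite /= mulr1 mulr0 addr0 [RHS]addrC subrK.
  - by rewrite mulr0 add0r mulr1 addrC subrK.
  - by rewrite !mulr0 !addr0.
rewrite det_1D_mulmx det_2x2.
have VU k l : (1%:M + V *m U) k l = \adj A (r k) (r l).
  rewrite mxE !mxE (bigD1 (r k)) //= big1 => [|i ik]; last first.
    by rewrite !mxE (negPf ik) mul0r.
  rewrite !mxE eqxx mul1r addr0.
  have -> : (r k == r l) = (k == l).
    by case: k => -[|[|k]] hk //; case: l => -[|[|l]] hl //;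
      rewrite /r -!val_eqE /= ?eqxx.
  by rewrite addrC subrK.
by rewrite !VU.
Qed.

(** Expansion along the first and the last column yields a factor [\det A] each; the other columns
    are those of [A]. *)
Let det_AX : \det (A *m X) =
  \det A ^+ 2 * \det (row' ord_max (col' ord_max (row' i0 (col' i0 A)))).
Proof.
have AX0 i j : (j == i0) || (j == i1) -> (A *m X) i j = \det A *+ (i == j).
  move=> hj; have := congr1 (fun M : 'M_n.+2 => M i j) (mul_mx_adj A).
  by rewrite !mxE => <-; apply: eq_bigr => k _; rewrite [X _ _]mxE hj.
have AX1 i j : ~~ ((j == i0) || (j == i1)) -> (A *m X) i j = A i j.
  move=> /negPf hj; rewrite mxE (bigD1 j) //= big1 => [|k kj].
    by rewrite mxE hj eqxx mulr1 addr0.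
  by rewrite mxE hj (negPf kj) mulr0.
have lmax : lift i0 ord_max = i1 by apply: val_inj.
rewrite (expand_det_col _ i0) (bigD1 i0) //= big1 => [|i ii0]; last first.
  by rewrite AX0 ?eqxx // (negPf ii0) mul0r.
rewrite AX0 ?eqxx // addr0 /cofactor addn0 expr0 mul1r expr2 -mulrA; congr (_ * _).
rewrite (expand_det_col _ ord_max) (bigD1 ord_max) //= big1 => [|i ii1]; last first.
  by rewrite 2!mxE lmax AX0 ?eqxx ?orbT // -lmax (inj_eq lift_inj) (negPf ii1) mul0r.
rewrite 2!mxE lmax AX0 ?eqxx ?orbT // addr0 /cofactor addnn -signr_odd odd_double mul1r.
congr (_ * \det _); apply/matrixP => i j.
do 4 rewrite [LHS]mxE.
rewrite AX1; first by rewrite !mxE.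
rewrite negb_or -lmax (inj_eq lift_inj) [_ == ord_max]eq_sym neq_lift andbT.
by rewrite eq_sym neq_lift.
Qed.

Lemma dodgson : \det A != 0 ->
  \det A * \det (row' ord_max (col' ord_max (row' i0 (col' i0 A)))) =
  \det (row' i0 (col' i0 A)) * \det (row' i1 (col' i1 A))
  - \det (row' i0 (col' i1 A)) * \det (row' i1 (col' i0 A)).
Proof.
move=> dA; apply: (mulfI dA); rewrite mulrA -expr2 -det_AX det_mulmx det_X.
congr (_ * _); rewrite !mxE /cofactor [(i0 + i1)%N]addnC.
have -> : (-1) ^+ (i0 + i0)%N = 1 :> F by [].
have -> : (-1) ^+ (i1 + i1)%N = 1 :> F by rewrite addnn -signr_odd odd_double.
(* The two off-diagonal corner cofactors carry the same sign, whose square is 1. *)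
rewrite !mul1r mulrACA -expr2 sqrr_sign mul1r; congr (_ - _); exact: mulrC.
Qed.

End Dodgson.

(** The minors involved are again Töplitz: deleting the first row and the last column raises [s] by
    one, deleting the last row and the first column lowers it by one. *)
Lemma toeplitz_dodgson (F : fieldType) (t q : F) (n : nat) (s : int) :
  narayana_toeplitz t q n.+2 s != 0 ->
  narayana_toeplitz t q n.+2 s * narayana_toeplitz t q n s =
  narayana_toeplitz t q n.+1 s ^+ 2 -
  narayana_toeplitz t q n.+1 (s + 1) * narayana_toeplitz t q n.+1 (s - 1).
Proof.
move=> /dodgson; rewrite /narayana_toeplitz => E.
transitivity (\det (\matrix_(j < n.+2, k < n.+2)
    narayana t q (s + j%:Z - k%:Z - 1)) * \det (row' ord_max (col' ord_max
  (row' ord0 (col' ord0 (\matrix_(j < n.+2, k < n.+2)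
    narayana t q (s + j%:Z - k%:Z - 1))))))).
  congr (_ * \det _); apply/matrixP => j k.
  by rewrite !mxE !lift0 !lift_max; congr (narayana t q _); lia.
rewrite E expr2; congr (_ * _ - _ * _); congr (\det _); apply/matrixP => j k;
  rewrite !mxE ?lift0 ?lift_max; congr (narayana t q _); lia.
Qed.

(** * Exponent arithmetic for [phi] *)

Definition tri (x : int) : int := (x * (x + 1) %/ 2)%Z.

Lemma triS (x : int) : tri (x + 1) = tri x + x + 1.
Proof.
rewrite /tri (_ : (x + 1) * (x + 1 + 1) = (x + 1) * 2 + x * (x + 1)); last by ring.
by rewrite divzMDl // addrC addrA.
Qed.

Lemma triM2 (x : int) : x * (x + 1) = tri x * 2.
Proof.
elim/int_ind: x => [//|n|n] IH.
  by rewrite -[n.+1]addn1 PoszD triS !mulrDl -IH; ring.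
have E := triS (- n.+1%:Z); rewrite (_ : - n.+1%:Z + 1 = - n%:Z) in E; last by lia.
by move: IH; rewrite E !mulrDl; lia.
Qed.

Lemma phiE (F : fieldType) (t q : F) (n : nat) (s : int) :
  phi t q n s = (-1) ^ tri (n%:Z - 1) * t ^ (- tri (n%:Z - s))
    * q ^ (tri (n%:Z - 1) * (2 * s - 1)).
Proof.
have E : n%:Z * (n%:Z - 1) = tri (n%:Z - 1) * 2 by rewrite -triM2 subrK mulrC.
by rewrite /phi E [_ * 2 * _]mulrAC !mulzK.
Qed.

Section Phi.
Variables (F : fieldType) (t q : F).
Hypotheses (t0 : t != 0) (q0 : q != 0).

Lemma phi_neq0 (n : nat) (s : int) : phi t q n s != 0.
Proof. by rewrite !mulf_neq0 ?expfz_neq0 // oppr_eq0 oner_eq0. Qed.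

Let m1 : -1 != 0 :> F. Proof. by rewrite oppr_eq0 oner_eq0. Qed.

Let mulX (a b c a' b' c' : int) :
  (-1) ^ a * t ^ b * q ^ c * ((-1) ^ a' * t ^ b' * q ^ c') =
  (-1) ^ (a + a') * t ^ (b + b') * q ^ (c + c').
Proof. by rewrite !expfzDr //; ring. Qed.

Let tE : t = (-1) ^ 0 * t ^ 1 * q ^ 0.
Proof. by rewrite !expr0z expr1z mulr1 mul1r. Qed.

(** The second difference of [tri] is 1, which accounts for the extra factor [t]. This and
    [phi_size] are the two ratios that the Desnanot-Jacobi step needs. *)
Lemma phi_shift (n : nat) (s : int) :
  t * (phi t q n (s + 1) * phi t q n (s - 1)) = phi t q n s ^+ 2.
Proof.
rewrite expr2 !phiE [X in X * (_ * _) = _]tE !mulX.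
congr ((-1) ^ _ * t ^ _ * q ^ _); try ring.
have -> : n%:Z - (s - 1) = n%:Z - s + 1 by ring.
have -> : n%:Z - s = n%:Z - (s + 1) + 1 by ring.
rewrite !triS; ring.
Qed.

Lemma phi_size (n : nat) (s : int) :
  t * (phi t q n.+2 s * phi t q n s) = - q ^ (2 * s - 1) * phi t q n.+1 s ^+ 2.
Proof.
have -> : - q ^ (2 * s - 1) = (-1) ^ 1 * t ^ 0 * q ^ (2 * s - 1).
  by rewrite expr0z expr1z mulr1 mulN1r.
rewrite expr2 !phiE [X in X * (_ * _) = _]tE !mulX.
have -> : n.+2%:Z - 1 = n%:Z - 1 + 1 + 1 by lia.
have -> : n.+1%:Z - 1 = n%:Z - 1 + 1 by lia.
have -> : n.+2%:Z - s = n%:Z - s + 1 + 1 by lia.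
have -> : n.+1%:Z - s = n%:Z - s + 1 by lia.
rewrite !triS; congr ((-1) ^ _ * t ^ _ * q ^ _); ring.
Qed.

Lemma phi_sym (n : nat) (s : int) :
  phi t q n s = t ^ (n%:Z * (2 * s - 1)) * phi t q^-1 n (1 - s).
Proof.
rewrite !phiE exprz_inv mulrCA -!mulrA [t ^ _ * (t ^ _ * _)]mulrA -expfzDr //.
congr (_ * (t ^ _ * q ^ _)); last by ring.
have : tri (n%:Z - (1 - s)) * 2 - tri (n%:Z - s) * 2 = n%:Z * (2 * s - 1) * 2.
  by rewrite -!triM2; ring.
by move=> E; apply: (@mulIf _ 2) => //; rewrite mulrDl -E; ring.
Qed.

Lemma phi1 (n : nat) : phi t q n 1 = \prod_(k < n) (- (q / t)) ^+ k.
Proof.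
elim: n => [|n IH]; first by rewrite big_ord0 /phi !mulr1.
rewrite big_ord_recr /= -IH !phiE.
have -> : (- (q / t)) ^+ n = (-1) ^ n%:Z * t ^ (- n%:Z) * q ^ n%:Z.
  by rewrite exprNn exprMn exprVn exprnN mulrA mulrAC.
rewrite mulX -[n.+1]addn1 PoszD addrK.
have E := triS (n%:Z - 1); rewrite subrK in E; rewrite E.
by congr ((-1) ^ _ * t ^ _ * q ^ _); ring.
Qed.
End Phi.

(** * The product factor and the induction on [s] *)

Definition aztec (F : fieldType) (t q : F) (s : nat) : F :=
  \prod_(1 <= k < s) (t + q ^+ (2 * k - 1)) ^+ (s - k).

Lemma aztecS (F : fieldType) (t q : F) (s : nat) :
  aztec t q s.+1 = aztec t q s * \prod_(1 <= k < s.+1) (t + q ^+ (2 * k - 1)).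
Proof.
case: s => [|s]; first by rewrite /aztec !big_geq // mulr1.
rewrite /aztec [LHS]big_nat_recr //= [X in _ = _ * X]big_nat_recr //= mulrA subSnn expr1.
congr (_ * _); rewrite -big_split; apply: eq_big_nat => k /andP[_ ks] /=.
by rewrite subSn 1?ltnW // exprSr.
Qed.

(** By [aztecS], successive quotients of [aztec] differ by a single new factor. *)
Lemma aztec_rec (F : fieldType) (t q : F) (s : nat) :
  aztec t q s.+2 * aztec t q s = aztec t q s.+1 ^+ 2 * (t + q ^+ (2 * s + 1)).
Proof.
rewrite (aztecS _ _ s.+1) big_nat_recr //= expr2 {3}aztecS.
by rewrite (_ : (2 * s.+1 - 1 = 2 * s + 1)%N); [ring | lia].
Qed.

Lemma toeplitz1 (F : fieldType) (t q : F) (n : nat) : t != 0 -> q != 0 ->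
  narayana_toeplitz t q n 1 = phi t q n 1.
Proof. by move=> t0 q0; rewrite toeplitz1_prod // phi1. Qed.

(** [n] stays general in the induction: reaching s + 2 at size n + 1 uses s + 1 at sizes n, n + 1, n
    + 2 and s at size n + 1. *)
Lemma toeplitz_generic (F : fieldType) (t q : F) (s n : nat) :
  t != 0 -> q != 0 -> (forall k : nat, t + q ^+ k != 0) -> (s <= n.+1)%N ->
  narayana_toeplitz t q n s%:Z = phi t q n s%:Z * aztec t q s.
Proof.
move=> t0 q0 tq0.
have az0 r : aztec t q r != 0.
  rewrite /aztec; elim/big_ind: _ => [|x y|k _]; rewrite ?oner_neq0 ?expf_neq0 //.
  exact: mulf_neq0.
elim/ltn_ind: s n => -[|[|s]] IH n sn.
- by rewrite toeplitz_sym // toeplitz1 ?invr_neq0 // -phi_sym // /aztec big_geq ?mulr1.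
- by rewrite toeplitz1 // /aztec big_geq ?mulr1.
case: n sn => // n; rewrite !ltnS => sn.
have s1 m : (s <= m)%N ->
    narayana_toeplitz t q m s.+1%:Z = phi t q m s.+1%:Z * aztec t q s.+1.
  by move=> sm; apply: IH.
have s0 := IH s (leqW (ltnSn s)) n.+1 (leqW (leqW sn)).
have := @toeplitz_dodgson F t q n s.+1%:Z.
have -> : s.+1%:Z - 1 = s%:Z by lia.
have -> : s.+1%:Z + 1 = s.+2%:Z by lia.
rewrite s0 !s1 ?(leqW (leqW sn)) ?(leqW sn) //.
have n0 := mulf_neq0 (phi_neq0 t0 q0 n.+2 s.+1) (az0 s.+1).
move=> /(_ n0) E.
(* The determinant for [s] is cancelled at the end; the factor [t] prepares for [phi_size] and
   [phi_shift]. *)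
apply: (mulIf (mulf_neq0 (phi_neq0 t0 q0 n.+1 s) (az0 s))); apply: (mulfI t0).
have -> : t * (narayana_toeplitz t q n.+1 s.+2 * (phi t q n.+1 s * aztec t q s)) =
  t * (phi t q n.+1 s.+1 * aztec t q s.+1) ^+ 2
   - (t * (phi t q n.+2 s.+1 * phi t q n s.+1)) * aztec t q s.+1 ^+ 2.
  set u := narayana_toeplitz t q n.+1 s.+2 * _.
  set v := (phi t q n.+1 s.+1 * _) ^+ 2.
  have -> : t * u = t * (v - (v - u)) by ring.
  by rewrite -E; ring.
rewrite phi_size //.
(* The minus sign in [phi_size] turns the difference into a multiple of t + q^(2s+1), the factor in
   [aztec_rec]. *)
transitivity (t * (phi t q n.+1 (s.+1%:Z + 1) * phi t q n.+1 (s.+1%:Z - 1))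
    * (aztec t q s.+2 * aztec t q s)).
  rewrite phi_shift // aztec_rec.
  have -> : q ^ (2 * s.+1%:Z - 1) = q ^+ (2 * s + 1) by rewrite exprnP; congr (_ ^ _); lia.
  by ring.
have -> : s.+1%:Z - 1 = s%:Z by lia.
have -> : s.+1%:Z + 1 = s.+2%:Z by lia.
by ring.
Qed.

(** * Specialization of rational functions at a point *)

Section Specialization.
Variables (F : fieldType) (x : F).
Local Notation K := {fraction {poly F}}.

(* The rational function u is regular at x and has the value y there. *)
Definition evaluates (u : K) (y : F) : Prop :=
  exists a b : {poly F}, [/\ b.[x] != 0, u * tofrac b = tofrac a & y * b.[x] = a.[x]].

(** This carries an identity in [K] over to [F]: both sides are one rational function, evaluated in
    two ways. *)
Lemma evaluates_inj (u : K) (y z : F) : evaluates u y -> evaluates u z -> y = z.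
Proof.
move=> [a [b [b0 ub yb]]] [c [d [d0 ud zd]]].
have : a * d = c * b.
  by apply/eqP; rewrite -tofrac_eq !rmorphM /= -ub -ud mulrAC.
move=> /(congr1 (horner^~ x)); rewrite !hornerM -yb -zd => E.
by apply: (mulIf (mulf_neq0 b0 d0)); rewrite mulrA E -!mulrA [b.[x] * _]mulrC.
Qed.

Lemma evaluates_poly (a : {poly F}) : evaluates (tofrac a) a.[x].
Proof. by exists a, 1; rewrite hornerC oner_neq0 rmorph1 !mulr1. Qed.

Lemma evaluates_C (c : F) : evaluates (tofrac c%:P) c.
Proof. by have := evaluates_poly c%:P; rewrite hornerC. Qed.

Lemma evaluates_X : evaluates (tofrac 'X) x.
Proof. by have := evaluates_poly 'X; rewrite hornerX. Qed.

Lemma evaluates_D (u v : K) (y z : F) :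
  evaluates u y -> evaluates v z -> evaluates (u + v) (y + z).
Proof.
move=> [a [b [b0 ub yb]]] [c [d [d0 vd zd]]]; exists (a * d + c * b), (b * d).
rewrite !rmorphD !rmorphM /= hornerD !hornerM -ub -vd -yb -zd mulf_neq0 //.
by split => //; ring.
Qed.

Lemma evaluates_M (u v : K) (y z : F) :
  evaluates u y -> evaluates v z -> evaluates (u * v) (y * z).
Proof.
move=> [a [b [b0 ub yb]]] [c [d [d0 vd zd]]]; exists (a * c), (b * d).
rewrite !rmorphM /= !hornerM -ub -vd -yb -zd mulf_neq0 //.
by split => //; ring.
Qed.

(** A nonzero value means that the numerator does not vanish at [x], so it can serve as
    denominator. *)
Lemma evaluates_V (u : K) (y : F) : y != 0 -> evaluates u y -> evaluates u^-1 y^-1.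
Proof.
move=> y0 [a [b [b0 ub yb]]]; exists b, a.
have a0 : a.[x] != 0 by rewrite -yb mulf_neq0.
split => //; last by rewrite -yb mulKf.
rewrite -ub mulKf //; apply: contraNneq a0 => u0.
by move: ub; rewrite u0 mul0r => /esym/eqP; rewrite tofrac_eq0 => /eqP->; rewrite horner0.
Qed.

Lemma evaluates_1 : evaluates 1 1.
Proof. by have := evaluates_C 1; rewrite rmorph1. Qed.

Lemma evaluates_0 : evaluates 0 0.
Proof. by have := evaluates_C 0; rewrite rmorph0. Qed.

Lemma evaluates_sum (I : Type) (r : seq I) (P : pred I) (f : I -> K) (g : I -> F) :
  (forall i, P i -> evaluates (f i) (g i)) ->
  evaluates (\sum_(i <- r | P i) f i) (\sum_(i <- r | P i) g i).
Proof.
move=> fg; elim/big_rec2: _ => [|i u y Pi]; first exact: evaluates_0.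
exact/evaluates_D/fg.
Qed.

Lemma evaluates_prod (I : Type) (r : seq I) (P : pred I) (f : I -> K) (g : I -> F) :
  (forall i, P i -> evaluates (f i) (g i)) ->
  evaluates (\prod_(i <- r | P i) f i) (\prod_(i <- r | P i) g i).
Proof.
move=> fg; elim/big_rec2: _ => [|i u y Pi]; first exact: evaluates_1.
exact/evaluates_M/fg.
Qed.

Lemma evaluates_exp (u : K) (y : F) (n : nat) :
  evaluates u y -> evaluates (u ^+ n) (y ^+ n).
Proof.
by move=> uy; elim: n => [|n IH]; [exact: evaluates_1 | rewrite !exprS; exact: evaluates_M].
Qed.

Lemma evaluates_expz (u : K) (y : F) (n : int) :
  y != 0 -> evaluates u y -> evaluates (u ^ n) (y ^ n).
Proof.
move=> y0 uy; case: n => n; first exact: evaluates_exp.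
by apply: evaluates_V; [rewrite expf_neq0 | exact: evaluates_exp].
Qed.

Lemma evaluates_N1 : evaluates (-1) (-1).
Proof. by have := evaluates_C (-1); rewrite polyCN rmorphN rmorph1. Qed.

Lemma evaluates_det (n : nat) (A : 'M[K]_n) (B : 'M[F]_n) :
  (forall i j, evaluates (A i j) (B i j)) -> evaluates (\det A) (\det B).
Proof.
(* By the Leibniz formula the determinant is a signed sum of products of entries. *)
move=> AB; apply: evaluates_sum => s _; apply: evaluates_M.
  exact/evaluates_exp/evaluates_N1.
by apply: evaluates_prod => i _; exact: AB.
Qed.

Section Toeplitz.
Variables (t q : K) (q' : F).
Hypotheses (x0 : x != 0) (q'0 : q' != 0).
Hypotheses (tx : evaluates t x) (qq' : evaluates q q').

Lemma evaluates_narayana (i : int) : evaluates (narayana t q i) (narayana x q' i).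
Proof.
have Nat (r : K) (r' : F) (k : nat) : r' != 0 -> evaluates r r' ->
    evaluates (narayana_nat t r k) (narayana_nat x r' k).
  move=> r'0 rr'; apply: evaluates_sum => p _.
  by apply: evaluates_M; [exact: evaluates_exp | exact: evaluates_expz].
rewrite /narayana; case: ifP => _; first exact: Nat.
apply: evaluates_M; first exact: evaluates_expz.
by apply: Nat; [rewrite invr_neq0 | exact: evaluates_V].
Qed.

Lemma evaluates_toeplitz (n : nat) (s : int) :
  evaluates (narayana_toeplitz t q n s) (narayana_toeplitz x q' n s).
Proof. by apply: evaluates_det => i j; rewrite !mxE; exact: evaluates_narayana. Qed.

Lemma evaluates_phi (n : nat) (s : int) : evaluates (phi t q n s) (phi x q' n s).
Proof.
have m1 : -1 != 0 :> F by rewrite oppr_eq0 oner_eq0.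
by apply: evaluates_M; [apply: evaluates_M|]; apply: evaluates_expz => //; exact: evaluates_N1.
Qed.

Lemma evaluates_aztec (s : nat) : evaluates (aztec t q s) (aztec x q' s).
Proof.
by apply: evaluates_prod => k _; apply/evaluates_exp/evaluates_D => //; exact: evaluates_exp.
Qed.

End Toeplitz.
End Specialization.

(** * Removal of the nonvanishing condition, and the theorem *)

Lemma toeplitz_pos (F : fieldType) (t q : F) (s n : nat) :
  t != 0 -> q != 0 -> (s <= n.+1)%N ->
  narayana_toeplitz t q n s%:Z = phi t q n s%:Z * aztec t q s.
Proof.
move=> t0 q0 sn.
pose T : {fraction {poly F}} := tofrac 'X; pose Q : {fraction {poly F}} := tofrac q%:P.
have TX : evaluates t T t := evaluates_X t.
have QC : evaluates t Q q := evaluates_C t q.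
have E : narayana_toeplitz T Q n s%:Z = phi T Q n s%:Z * aztec T Q s.
  apply: toeplitz_generic => //; rewrite ?tofrac_eq0 ?polyX_eq0 ?polyC_eq0 // => k.
  (* T + Q^k comes from the polynomial X + q^k, which has degree one and so is not zero. *)
  rewrite -rmorphXn -rmorphD tofrac_eq0 -polyC_exp /=.
  by rewrite -size_poly_eq0 size_XaddC.
apply: (@evaluates_inj F t (narayana_toeplitz T Q n s%:Z)).
  exact: evaluates_toeplitz.
by rewrite E; apply: evaluates_M; [exact: evaluates_phi | exact: evaluates_aztec].
Qed.

Theorem theorem9 (F : fieldType) (t q : F) (ht : t != 0) (hq : q != 0)
    (n : nat) (s : int) (hs : - n%:Z <= s <= n%:Z + 1) :
  (1 <= s <= n%:Z + 1 ->
     narayana_toeplitz t q n s =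
     phi t q n s *
     \prod_(1 <= k < `|s|%N) (t + q ^ (2 * k%:Z - 1)) ^ (s - k%:Z))
  /\
  (- n%:Z <= s <= 0 ->
     narayana_toeplitz t q n s =
     phi t q n s *
     \prod_(1 <= k < `|s|%N.+1)
       (t + q ^ (- (2 * k%:Z) + 1)) ^ (`|s| - k%:Z + 1)).
Proof.
have expE (x : F) (m : nat) (z : int) : z = m%:Z -> x ^+ m = x ^ z by move=> ->.
split=> /andP[s_ge s_le].
  have [m sE] : exists m : nat, s = m%:Z by exists `|s|%N; lia.
  rewrite sE toeplitz_pos //; last by lia.
  congr (_ * _); apply: eq_big_nat => k /andP[k1 km].
  by rewrite (expE q _ (2 * k%:Z - 1)) 1?(expE _ _ (m%:Z - k%:Z)) //; lia.
have [m sE] : exists m : nat, s = - m%:Z by exists `|s|%N; lia.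
(* Both sides reflect to [1 - s] with the same power of [t]; passing to [q^-1] produces the negative
   exponents of q. *)
rewrite toeplitz_sym // phi_sym // -mulrA; congr (_ * _).
have -> : 1 - s = m.+1%:Z by lia.
rewrite toeplitz_pos ?invr_neq0 //; last by lia.
have -> : `|s|%N = m by lia.
congr (_ * _); apply: eq_big_nat => k /andP[k1 km].
rewrite (expE q^-1 _ (2 * k%:Z - 1)) ?exprz_inv; last by lia.
rewrite (expE _ _ (`|s| - k%:Z + 1)); last by lia.
by congr ((_ + q ^ _) ^ _); lia.
Qed.
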